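(* Let $(X,\mathcal{B},\mu,T)$ be the two-sided left Bernoulli shift on the two symbols $0,1$, each with weight $\frac12$; that is, $X=\{0,1\}^{\mathbb{Z}}$, $\mu$ is the product measure, and $(T(x))_n=x_{n+1}$. Let $\alpha\in(0,1)$ be irrational, and let $A$ be the matrix cocycle over $T$ generated by \[ A(1,x)=\begin{bmatrix}\cos(\pi\alpha)&-\sin(\pi\alpha)\\ \sin(\pi\alpha)&\cos(\pi\alpha)\end{bmatrix}\ \text{ if } x_0=0,\qquad A(1,x)=\begin{bmatrix}1&0\\0&-1\end{bmatrix}\ \text{ if } x_0=1. \] Then the trivial bundle $X\times\mathbb{C}^2$ is irreducible for the cocycle $A$ over $(X,\mathcal{B},\mu,T)$.
   Context: The cocycle generated by $A(1,\cdot)$ is $A(0,x)=I$, $A(n,x)=A(1,T^{n-1}(x))\cdots A(1,x)$ and $A(-n,x)=A(1,T^{-n}(x))^{-1}\cdots A(1,T^{-1}(x))^{-1}$ for $n>0$. An invariant (measurable) vector bundle in $X\times\mathbb{C}^2$ for $A$ is given by a measurable map $x\mapsto V(x)$ into complex subspaces of $\mathbb{C}^2$ (measurable with respect to the Grassmannian) for which there is a $T$-invariant set $\tilde X\subset X$ of full measure such that $A(1,x)V(x)=V(T(x))$ for all $x\in\tilde X$. An invariant bundle $V$ is reducible if there is an invariant vector bundle $W$ with $\{0\}\subsetneq W(x)\subsetneq V(x)$ for $\mu$-almost every $x$; otherwise it is irreducible. $X\times\mathbb{C}^2$ denotes the trivial bundle $V(x)=\mathbb{C}^2$. *)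

(* Defs.v *)
From HB Require Import structures.
From mathcomp Require Import all_boot all_order all_algebra.
From mathcomp Require Import complex.
From mathcomp Require Import all_classical all_reals all_analysis.
Set Implicit Arguments.
Unset Strict Implicit.
Unset Printing Implicit Defensive.
Import Order.TTheory GRing.Theory Num.Theory.
Import numFieldNormedType.Exports.
Local Open Scope classical_set_scope.
Local Open Scope ring_scope.
Local Open Scope complex_scope.

Section cocycles.
Variables (F : fieldType) (X : Type).

Fixpoint cocycle_pos (T : X -> X) (a : X -> 'M[F]_2) (n : nat) (x : X) :
    'M[F]_2 :=
  if n is m.+1 then a (iter m T x) *m cocycle_pos T a m x else 1%:M.

(* [Tinv] is meant to be the inverse of [T]; [cocycle_neg Tinv a n] is
   A(-n, -). *)
Fixpoint cocycle_neg (Tinv : X -> X) (a : X -> 'M[F]_2) (n : nat) (x : X) :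
    'M[F]_2 :=
  if n is m.+1 then invmx (a (iter m.+1 Tinv x)) *m cocycle_neg Tinv a m x
  else 1%:M.

Definition cocycle (T Tinv : X -> X) (a : X -> 'M[F]_2) (n : int) (x : X) :
    'M[F]_2 :=
  match n with
  | Posz m => cocycle_pos T a m x
  | Negz m => cocycle_neg Tinv a m.+1 x
  end.

End cocycles.

(* The image {M v | v in U}. *)
Definition mximg (F : fieldType) (m k : nat) (M : 'M[F]_(m, k))
    (U : {vspace 'cV[F]_k}) : {vspace 'cV[F]_m} :=
  (linfun (mulmx M : 'cV[F]_k -> 'cV[F]_m) @: U)%VS.

Definition proper_subv (F : fieldType) (vT : vectType F)
    (U V : {vspace vT}) : Prop :=
  (U <= V)%VS /\ U <> V.

(* All complex subspaces of C^2, of dimension 0, 1 or 2. *)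
Definition grassmannian (R : realType) : Type := {vspace 'cV[R[i]]_2}.

HB.instance Definition _ (R : realType) := Choice.on (grassmannian R).
HB.instance Definition _ (R : realType) :=
  isPointed.Build (grassmannian R) (0%VS : {vspace 'cV[R[i]]_2}).

(* The topology is that of the disjoint union over k of the spaces of
   k-dimensional subspaces, each being the quotient of the space of 2 x k
   matrices of rank k by M |-> column space of M. Since the matrices of rank k
   form an open set, openness may be tested among all 2 x k matrices, whose
   topology is induced by the modulus on [R[i]^o]. *)
Definition grass_open (R : realType) : set (set (grassmannian R)) :=
  [set U | forall k : nat,
     open [set M : 'M[R[i]^o]_(2, k) |
       \rank (M : 'M[R[i]]_(2, k)) = k /\
       U (mximg (M : 'M[R[i]]_(2, k)) fullv)]].

Definition grass_borel (R : realType) :=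
  g_sigma_algebraType (@grass_open R).

Section bundles.
Variables (R : realType) (d : measure_display) (X : measurableType d).
Variables (mu : probability X R) (T : X -> X) (A : int -> X -> 'M[R[i]]_2).

Definition invariant_bundle (V : X -> grassmannian R) : Prop :=
  measurable_fun setT (V : X -> grass_borel R) /\
  exists X' : set X,
    [/\ measurable X', mu X' = 1%E, T @^-1` X' = X' &
        forall x, X' x -> mximg (A 1 x) (V x) = V (T x)].

Definition reducible (V : X -> grassmannian R) : Prop :=
  exists W : X -> grassmannian R,
    invariant_bundle W /\
    {ae mu, forall x, proper_subv 0%VS (W x) /\ proper_subv (W x) (V x)}.

Definition irreducible (V : X -> grassmannian R) : Prop :=
  invariant_bundle V /\ ~ reducible V.

Definition trivial_bundle (x : X) : grassmannian R := fullv.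

End bundles.

(* {0,1}^Z, with [false] for 0 and [true] for 1, and the product
   sigma-algebra, generated by the one-coordinate cylinders. *)
Definition bernoulli_space :=
  g_sigma_algebraType
    [set [set x : int -> bool | x c.1 = c.2] | c in [set: int * bool]].

Definition bernoulli_shift (x : bernoulli_space) : bernoulli_space :=
  fun n => x (n + 1).

Definition bernoulli_unshift (x : bernoulli_space) : bernoulli_space :=
  fun n => x (n - 1).

(* The product measure is determined by its values on cylinders. *)
Definition bernoulli_half (R : realType) (mu : probability bernoulli_space R) :
    Prop :=
  forall (s : seq int) (a : int -> bool), uniq s ->
    mu [set x : bernoulli_space | forall n, n \in s -> x n = a n] =
    ((2^-1 : R) ^+ size s)%:E.

Definition mx2 (F : fieldType) (a b c d : F) : 'M[F]_2 :=
  \matrix_(i < 2, j < 2)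
    if i == 0 then (if j == 0 then a else b) else (if j == 0 then c else d).

Definition rot_refl (R : realType) (alpha : R) (x : bernoulli_space) :
    'M[R[i]]_2 :=
  if x 0 then mx2 1 0 0 (- 1)
  else mx2 (cos (pi * alpha))%:C (- sin (pi * alpha))%:C
           (sin (pi * alpha))%:C (cos (pi * alpha))%:C.

(* Main.v *)
Require Import Defs.
From mathcomp Require Import all_boot all_order all_algebra.
From mathcomp Require Import complex ring lra.
From mathcomp Require Import all_classical all_reals all_analysis.
From mathcomp Require Import measurable_realfun.

(** A proper invariant subbundle would be a measurable field of lines [W] in
    C^2 with [A(1,x) W(x) = W(T x)] almost everywhere.  The matrices are real
    orthogonal, hence act on the Riemann sphere of complex lines by rigid
    motions.  In Stokes (Bloch) coordinates [(u, v, w)] on that sphere the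
    letter 0 turns [(u, v)] by the angle [2 pi alpha] and fixes [w], and the
    letter 1 changes the signs of [v] and [w].  Thus [W] becomes a measurable
    equivariant map [h] from the shift space to the unit sphere of R^3, and it
    is shown that no such map exists ([equivariant_eq0]).

    Let [flip k] change the letter at place [k], and let [D k x] be the squared
    distance between [h (flip k x)] and [h x].  As [flip k (T x)] is
    [T (flip (k + 1) x)], and as [x] and [flip (k + 1) x] have the same letter
    at place 0 unless [k = -1], the isometry that carries the value of [h] at a
    point to its value at the image under [T] is the same for both, so
    [D k (T x) = D (k + 1) x].  The measure being invariant, [D 0, D 1, ...] are
    equidistributed, and so are [D (-1), D (-2), ...] ([flip_dist_step]).  On
    the other hand a measurable set is almost determined by finitely many
    letters, so that it is almost unchanged by a flip at a far away place, and
    [D k] tends to 0 in measure as [k] goes to either infinity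
    ([asymp_invariant_generated], [asymp_invariant_fun],
    [flip_dist_vanishing]).  Hence [D 0] and [D (-1)] vanish almost everywhere.

    So neither [h x] nor [h (T x)] changes when the letter [x 0] does, which
    means that both letters send [h x] to the same vector.  This gives [w = 0]
    and makes [(u, v)] invariant under a reflection, the product of the two
    letters.  As [h (T x)] is then [(u, - v, 0)] and has the same property,
    [(u, v)] lies on the axis of that reflection and on the mirror image of this
    axis in the first coordinate axis.  The two are distinct when
    [sin (2 pi alpha) <> 0], that is, for [alpha] in (0, 1), when
    [alpha <> 1/2]; so [h = 0], although [h] has norm 1.

    It remains to see that the Stokes coordinates are Borel functions on the
    Grassmannian ([measurable_chart]). *)

Set Implicit Arguments.
Unset Strict Implicit.
Unset Printing Implicit Defensive.
Import Order.TTheory GRing.Theory Num.Theory.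
Import numFieldNormedType.Exports.
Local Open Scope classical_set_scope.
Local Open Scope ring_scope.
Local Open Scope complex_scope.

(** * Measure-preserving maps and asymptotically invariant sets *)

Lemma ae_le_measure d (X : measurableType d) (R : realType)
    (mu : {measure set X -> \bar R}) (A B : set X) :
  measurable A -> measurable B -> {ae mu, forall x, A x -> B x} ->
  (mu A <= mu B)%E.
Proof.
move=> mA mB [N [mN N0 ABN]].
apply: (@le_trans _ _ (mu (B `|` N))).
  apply: le_measure; rewrite ?inE//; first exact: measurableU.
  move=> x Ax; have [Bx|nBx] := pselect (B x); [by left|right].
  by apply: ABN => /= /(_ Ax).
apply: (le_trans (measureU2 _ _ _)) => //.
by rewrite [X in (_ + X)%E](_ : _ = 0%E) ?adde0.
Qed.

Section asymptotic_invariance.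
Context d (X : measurableType d) (R : realType) (mu : probability X R).

Definition measure_preserving (f : X -> X) : Prop :=
  measurable_fun setT f /\
  forall E, measurable E -> mu (f @^-1` E) = mu E.

Lemma ae_preimage (f : X -> X) (P : set X) : measure_preserving f ->
  {ae mu, forall x, P x} -> {ae mu, forall x, P (f x)}.
Proof.
move=> [mf pf] [N [mN N0 PN]]; exists (f @^-1` N); split.
- by rewrite -[X in measurable X]setTI; exact: mf.
- by rewrite pf.
- by move=> x /= Px; apply: PN.
Qed.

Lemma measurable_superlevel (h : X -> R) (e : R) :
  measurable_fun setT h -> measurable [set x | e <= h x].
Proof.
move=> mh; rewrite (_ : mkset _ = setT `&` h @^-1` `[e, +oo[%classic).
  by apply: mh => //; exact: measurable_itv.
by rewrite setTI; apply/seteqP; split=> x /=; rewrite in_itv/= andbT.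
Qed.

Lemma measurable_displacement (f : X -> X) (h : X -> R) :
  measure_preserving f -> measurable_fun setT h ->
  measurable_fun setT (fun x => `|h (f x) - h x|).
Proof.
move=> [mf _] mh; apply: measurableT_comp => //; apply: measurable_funB => //.
exact: measurableT_comp.
Qed.

(** Convergence to 0 of a sequence of measures, in the form in which unions are
    easiest to handle. *)
Definition vanishing (u : nat -> \bar R) : Prop :=
  forall e : R, 0 < e -> \forall n \near \oo, (u n <= e%:E)%E.

Definition asymp_invariant (f : nat -> X -> X) (E : set X) : Prop :=
  vanishing (fun n => mu (E `+` f n @^-1` E)).

Variable f : nat -> X -> X.
Hypothesis fP : forall n, measure_preserving (f n).

Lemma vanishingS (A B : nat -> set X) : (forall n, measurable (A n)) ->
  (forall n, measurable (B n)) -> (forall n, A n `<=` B n) ->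
  vanishing (mu \o B) -> vanishing (mu \o A).
Proof.
move=> mA mB AB Bv e e0; apply: filterS (Bv _ e0) => n /=.
by move=> Bn; apply: le_trans Bn; apply: le_measure; rewrite ?inE.
Qed.

Lemma vanishingU (A B : nat -> set X) : (forall n, measurable (A n)) ->
  (forall n, measurable (B n)) ->
  vanishing (mu \o A) -> vanishing (mu \o B) ->
  vanishing (fun n => mu (A n `|` B n)).
Proof.
move=> mA mB Av Bv e e0; have e20 : 0 < e / 2 by rewrite divr_gt0.
apply: filterS2 (Av _ e20) (Bv _ e20) => n /= An Bn.
apply: (le_trans (measureU2 _ _ _)) => //.
by rewrite [e]splitr EFinD; exact: leeD.
Qed.

Lemma measurable_symdiff n (E : set X) : measurable E ->
  measurable (E `+` f n @^-1` E).
Proof.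
move=> mE; have mfE : measurable (f n @^-1` E).
  by rewrite -[X in measurable X]setTI; exact: (fP n).1.
by rewrite /setY; apply: measurableU; exact: measurableD.
Qed.

Lemma asymp_invariantC (E : set X) :
  asymp_invariant f E -> asymp_invariant f (~` E).
Proof.
move=> Ei e /Ei; apply: filterS => n; congr (mu _ <= _)%E.
rewrite preimage_setC; apply/seteqP; split=> x /=; rewrite /setY /=;
  case: (pselect (E x)); case: (pselect (E (f n x))); tauto.
Qed.

Lemma asymp_invariantU (E F : set X) : measurable E -> measurable F ->
  asymp_invariant f E -> asymp_invariant f F -> asymp_invariant f (E `|` F).
Proof.
move=> mE mF Ei Fi.
apply: (@vanishingS _
  (fun n => (E `+` f n @^-1` E) `|` (F `+` f n @^-1` F))).
- by move=> n; apply: measurable_symdiff; exact: measurableU.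
- by move=> n; apply: measurableU; exact: measurable_symdiff.
- move=> n x /=; rewrite /setY /=; case: (pselect (E x));
  case: (pselect (E (f n x))); case: (pselect (F x));
  case: (pselect (F (f n x))); tauto.
- by apply: vanishingU => // n; exact: measurable_symdiff.
Qed.

Lemma asymp_invariant0 : asymp_invariant f set0.
Proof.
move=> e e0; apply: nearW => n.
by rewrite preimage_set0 /setY !setDv setU0 measure0 lee_fin ltW.
Qed.

(** A countable union is exhausted by its finite subunions up to a set of small
    measure.  Since [f n] preserves the measure, the preimage of that set is
    equally small, uniformly in [n]. *)
Lemma asymp_invariant_bigcup (E : nat -> set X) :
  (forall k, measurable (E k)) -> (forall k, asymp_invariant f (E k)) ->
  asymp_invariant f (\bigcup_k E k).
Proof.
move=> mE Ei; pose F n := \big[setU/set0]_(k < n) E k.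
pose U := \bigcup_k E k.
have mF n : measurable (F n) by exact: bigsetU_measurable.
have mU : measurable U by exact: bigcupT_measurable.
have Fi n : asymp_invariant f (F n).
  rewrite /F; elim: n => [|n IHn].
    by rewrite big_ord0; exact: asymp_invariant0.
  rewrite big_ord_recr /=; apply: asymp_invariantU => //; exact: mF.
have FU n : F n `<=` U.
  by rewrite /F -bigcup_mkord => x [k _ Ex]; exists k.
have tail0 : \bigcap_n (U `\` F n) = set0.
  rewrite -subset0 => x /= Ux; have [[k _ Ex] _] := Ux 0%N I.
  have [_] := Ux k.+1 I; apply.
  by rewrite /F -bigcup_mkord; exists k => //=.
have tail : (mu \o (fun n => U `\` F n)) @ \oo --> 0%E.
  rewrite -(measure0 mu) -tail0; apply: nonincreasing_cvg_mu.
  - by rewrite (le_lt_trans (probability_le1 _ _)) ?ltry//; exact: measurableD.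
  - by move=> n; exact: measurableD.
  - by rewrite tail0.
  - move=> m n mn; apply/subsetPset; apply: setDS.
    exact: subset_bigsetU.
move=> e e0; have e30 : 0 < e / 3 by rewrite divr_gt0.
have [N muN] : exists N, (mu (U `\` F N) <= (e / 3)%:E)%E.
  move/fine_cvgP : tail => [fin /cvgr0_norm_le/(_ _ e30) Ne].
  have [N _ NP] := filterI fin Ne.
  have [/= finN leN] := NP N (leqnn N).
  exists N; rewrite -(fineK finN) lee_fin.
  exact: le_trans (ler_norm _) leN.
apply: filterS (Fi N _ e30) => n Fn.
have mfD : measurable (f n @^-1` (U `\` F N)).
  rewrite -[X in measurable X]setTI; apply: (fP n).1 => //.
  exact: measurableD.
apply: (@le_trans _ _ (mu ((F N `+` f n @^-1` F N) `|` (U `\` F N) `|`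
    f n @^-1` (U `\` F N)))).
  apply: le_measure; rewrite ?inE.
  - exact: measurable_symdiff.
  - by do 2?apply: measurableU => //;
      [exact: measurable_symdiff|exact: measurableD].
  - move=> x; rewrite /setY /=.
    have := FU N x; have := FU N (f n x); rewrite -/U.
    by case: (pselect (F N x)); case: (pselect (F N (f n x))); tauto.
apply: (le_trans (measureU2 _ _ _)) => //.
  by apply: measurableU => //; [exact: measurable_symdiff|exact: measurableD].
have -> : e = e / 3 + e / 3 + e / 3 by lra.
rewrite !EFinD; apply: leeD.
  apply: (le_trans (measureU2 _ _ _)) => //.
  - exact: measurable_symdiff.
  - exact: measurableD.
  - exact: leeD.
rewrite [X in (X <= _)%E](_ : _ = mu (U `\` F N)) //.
by apply: (fP n).2; exact: measurableD.
Qed.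

(** The asymptotically invariant measurable sets form a sigma-algebra, so the
    property only has to be tested on generators. *)
Lemma asymp_invariant_generated (G : set (set X)) :
  @measurable _ X = <<s G >> -> G `<=` asymp_invariant f ->
  forall E, measurable E -> asymp_invariant f E.
Proof.
move=> mG Gi E mE.
suff: [set E | measurable E /\ asymp_invariant f E] E by case.
have : <<s G >> E by rewrite -mG.
apply; split; last first.
  by move=> A GA; split; [rewrite mG; exact: sub_sigma_algebra|exact: Gi].
split => [|A [mA Ai]|A mAi].
- by split => //; exact: asymp_invariant0.
- by rewrite setTD; split; [exact: measurableC|exact: asymp_invariantC].
- split; first by apply: bigcupT_measurable => k; exact: (mAi k).1.
  by apply: asymp_invariant_bigcup => k; [exact: (mAi k).1|exact: (mAi k).2].
Qed.

Hypothesis fi : forall E, measurable E -> asymp_invariant f E.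

(** A bounded function is determined up to [e] by finitely many of its
    superlevel sets, each of which is asymptotically invariant. *)
Lemma asymp_invariant_fun (h : X -> R) (e : R) : measurable_fun setT h ->
  (forall x, `|h x| <= 1) -> 0 < e ->
  vanishing (fun n => mu [set x | e <= `|h (f n x) - h x|]).
Proof.
move=> mh h1 e0; pose E j := [set x | -1 + e *+ j <= h x].
have mE j : measurable (E j) by exact: measurable_superlevel.
have [N eN] : exists N, 2 < e *+ N.
  exists (Num.bound (2 / e)); rewrite -[e *+ _]mulr_natl -ltr_pdivrMr//.
  by apply: archi_boundP; rewrite divr_ge0// ltW.
(* Two values of [h] that are at least [e] apart are separated by a threshold,
   and the range of [h] meets fewer than [N] of them. *)
have sep x y : e <= h y - h x -> exists2 j, (j < N)%N & ~ E j x /\ E j y.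
  move=> exy; have hx := h1 x; have hy := h1 y.
  move: hx hy; rewrite !ler_norml => /andP[hx1 hx2] /andP[hy1 hy2].
  have ex : exists j, h x < -1 + e *+ j by exists N; lra.
  case: (ex_minnP ex) => -[|j] hj jmin; first by move: hj; rewrite mulr0n; lra.
  have hj' : -1 + e *+ j <= h x.
    by rewrite leNgt; apply/negP => /jmin; rewrite ltnn.
  exists j.+1; last first.
    split; rewrite /E /= ?mulrSr; last lra.
    by apply/negP; rewrite -ltNge -mulrSr.
  rewrite ltnNge; apply/negP => Nj.
  have : e *+ N <= e *+ j.+1 by apply: ler_wpMn2l => //; exact: ltW.
  by rewrite mulrSr; lra.
pose B M n := \big[setU/set0]_(j < M) (E j `+` f n @^-1` E j).
have mB M n : measurable (B M n).
  by apply: bigsetU_measurable => j _; exact: measurable_symdiff.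
apply: (@vanishingS _ (B N)) => //.
- by move=> n; apply: measurable_superlevel; exact: measurable_displacement.
- move=> n x /=; rewrite ler_normr => /orP[|]; last rewrite opprB.
  + move=> /sep[j jN [Ex Ey]]; rewrite /B.
    rewrite -(bigcup_mkord N (fun j => E j `+` f n @^-1` E j)).
    exists j => //=.
    by rewrite /setY /=; tauto.
  + move=> /sep[j jN [Ex Ey]]; rewrite /B.
    rewrite -(bigcup_mkord N (fun j => E j `+` f n @^-1` E j)).
    exists j => //=.
    by rewrite /setY /=; tauto.
elim: {eN sep} N => [|M IHM].
  move=> r r0; apply: nearW => n.
  by rewrite /= /B big_ord0 measure0 lee_fin ltW.
rewrite /comp /B; under eq_fun do rewrite big_ord_recr/=.
apply: vanishingU => // [n|n|]; [exact: mB|exact: measurable_symdiff|exact: fi].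
Qed.

End asymptotic_invariance.

(** * Flips and the shift on the Bernoulli space *)

Section bernoulli.
Context (R : realType) (mu : probability bernoulli_space R).
Hypothesis hmu : bernoulli_half mu.

Definition coord_sets : set (set bernoulli_space) :=
  [set [set x : int -> bool | x c.1 = c.2] | c in [set: int * bool]].

Definition cylinder (s : seq int) (a : int -> bool) : set bernoulli_space :=
  [set x | forall n, n \in s -> x n = a n].

Lemma measurable_bernoulliE :
  @measurable _ bernoulli_space = <<s coord_sets >>.
Proof. by []. Qed.

Lemma measurable_coord n b : measurable [set x : bernoulli_space | x n = b].
Proof.
by rewrite measurable_bernoulliE; apply: sub_sigma_algebra; exists (n, b).
Qed.

Lemma measurable_cylinder s a : measurable (cylinder s a).
Proof.
elim: s => [|m s IHs].
  by rewrite (_ : cylinder _ _ = setT)//; apply/seteqP; split.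
rewrite (_ : cylinder _ _ = [set x | x m = a m] `&` cylinder s a).
  by apply: measurableI => //; exact: measurable_coord.
apply/seteqP; split => x /=.
  by move=> xs; split => [|n ns]; apply: xs; rewrite inE ?eqxx ?ns ?orbT.
by move=> [xm xs] n; rewrite inE => /orP[/eqP->//|]; exact: xs.
Qed.

Lemma measurable_cylinder_generated :
  @measurable _ bernoulli_space =
  <<s [set E | E = set0 \/ exists s a, uniq s /\ E = cylinder s a]>>.
Proof.
apply/seteqP; split; apply: smallest_sub; try exact: smallest_sigma_algebra.
- move=> _ [[n b] _ <-]; apply: sub_sigma_algebra; right.
  exists [:: n], (fun=> b); split => //; apply/seteqP; split => x /=.
    by move=> xn m; rewrite inE => /eqP->.
  by move=> /(_ n); apply; rewrite inE.
- move=> E [->|[s [a [_ ->]]]]; first exact: measurable0.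
  exact: measurable_cylinder.
Qed.

(** The cylinders form, together with the empty set, a pi-system that generates
    the sigma-algebra; by uniqueness of measures it suffices to know the
    measure of their preimages. *)
Lemma bernoulli_measure_preserving (f : bernoulli_space -> bernoulli_space) :
  (forall n b, measurable (f @^-1` [set x | x n = b])) ->
  (forall s a, uniq s -> mu (f @^-1` cylinder s a) = mu (cylinder s a)) ->
  measure_preserving mu f.
Proof.
move=> mcf cf.
have mf : measurable_fun setT f.
  apply: (measurability _ measurable_bernoulliE) => _ [_ [[n b] _ <-] <-].
  by rewrite setTI; exact: mcf.
split => // E mE.
pose G := [set E | E = set0 \/ exists s a, uniq s /\ E = cylinder s a].
apply: (@measure_unique _ _ _ G (fun=> setT) _ _ _ _ (pushforward mu f) mu)
  => //.
- exact: measurable_cylinder_generated.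
- move=> A B [->|[s [a [us ->]]]]; first by left; rewrite set0I.
  move=> [->|[t [b [ut ->]]]]; first by left; rewrite setI0.
  have [[n [ns nt nab]]|agree] :=
    pselect (exists n, [/\ n \in s, n \in t & a n != b n]).
    left; rewrite -subset0 => x /= [xs xt]; move: nab.
    by rewrite -(xs _ ns) -(xt _ nt) eqxx.
  right; exists (undup (s ++ t)), (fun n => if n \in s then a n else b n).
  split; first exact: undup_uniq.
  apply/seteqP; split => x /=.
    move=> [xs xt] n; rewrite mem_undup mem_cat.
    by case: ifPn => [/xs//|_ /= /xt].
  move=> xst; split => n nin; rewrite (xst n) ?mem_undup ?mem_cat ?nin ?orbT//.
  case: ifPn => // ns; apply: contrapT => /eqP nab.
  by apply: agree; exists n.
- by move=> i; right; exists [::], xpredT; split => //; apply/seteqP; split.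
- by rewrite bigcup_const.
- move=> A [->|[s [a [us ->]]]]; first by rewrite !measure0.
  exact: cf.
- move=> k /=; rewrite /pushforward preimage_setT.
  by rewrite (le_lt_trans (probability_le1 _ _))// ltry.
Qed.

Lemma bernoulli_shift_preserving : measure_preserving mu bernoulli_shift.
Proof.
apply: bernoulli_measure_preserving => [n b|s a us].
  exact: measurable_coord (n + 1) b.
have -> : bernoulli_shift @^-1` cylinder s a =
    cylinder [seq n + 1 | n <- s] (fun n => a (n - 1)).
  apply/seteqP; split => x /= xs n.
    by move=> /mapP[m ms ->] /=; rewrite addrK -(xs m ms).
  move=> ns; rewrite /bernoulli_shift (xs (n + 1)) /= ?addrK//.
  by apply/mapP; exists n.
rewrite [LHS]hmu ?[RHS]hmu ?size_map ?map_inj_uniq//.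
exact: addIr.
Qed.

Definition flip (k : int) (x : bernoulli_space) : bernoulli_space :=
  fun n => if n == k then ~~ x n else x n.

Lemma flip_preserving k : measure_preserving mu (flip k).
Proof.
apply: bernoulli_measure_preserving => [n b|s a us].
  rewrite (_ : _ @^-1` _ =
    [set x : bernoulli_space | x n = if n == k then ~~ b else b]).
    exact: measurable_coord.
  apply/seteqP; split => x /=; rewrite /flip; case: ifP => // _.
    by move=> <-; rewrite negbK.
  by move=> ->; rewrite negbK.
have -> : flip k @^-1` cylinder s a =
    cylinder s (fun n => if n == k then ~~ a n else a n).
  apply/seteqP; split => x /= xs n ns; have := xs n ns; rewrite /flip;
    by case: ifP => _; case: (x n); case: (a n).
by rewrite [LHS]hmu ?[RHS]hmu.
Qed.

Lemma flip_shift k x :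
  flip k (bernoulli_shift x) = bernoulli_shift (flip (k + 1) x).
Proof.
by apply/funext => n; rewrite /flip /bernoulli_shift (inj_eq (addIr _)).
Qed.

(** Far flips leave every one-coordinate set alone, and these sets generate. *)
Lemma flip_asymp_invariant (k : nat -> int) : injective k ->
  forall E, measurable E -> asymp_invariant mu (fun n => flip (k n)) E.
Proof.
move=> kinj; apply: (asymp_invariant_generated _ measurable_bernoulliE).
  by move=> n; exact: flip_preserving.
move=> _ [[m b] _ <-] e e0.
have kE n : k n != m ->
    [set x : bernoulli_space | x m = b] `+`
      flip (k n) @^-1` [set x | x m = b] = set0.
  move=> knm; rewrite (_ : flip (k n) @^-1` _ = [set x | x m = b]).
    by rewrite /setY setDv setU0.
  by apply/seteqP; split=> x /=; rewrite /flip eq_sym (negbTE knm).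
have [[N kN]|kN] := pselect (exists N, k N = m).
  exists N.+1 => // n /= Nn; rewrite kE ?measure0 ?lee_fin ?ltW//.
  by rewrite -kN (inj_eq kinj); case: ltngtP Nn.
apply: nearW => n; rewrite kE ?measure0 ?lee_fin ?ltW//.
by apply/eqP => knm; apply: kN; exists n.
Qed.

End bernoulli.

(** * Equivariant vector-valued functions vanish *)

Section equivariant.
Context (R : realType) (mu : probability bernoulli_space R).
Hypothesis hmu : bernoulli_half mu.
Variables (c s : R) (u v w : bernoulli_space -> R).
Hypotheses (cs : c ^+ 2 + s ^+ 2 = 1) (s0 : s != 0).
Hypotheses (mu_u : measurable_fun setT u) (mu_v : measurable_fun setT v)
  (mu_w : measurable_fun setT w).
Hypotheses (u1 : forall x, `|u x| <= 1) (v1 : forall x, `|v x| <= 1)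
  (w1 : forall x, `|w x| <= 1).

(** The letter [b] sends [(p, q, r)] to [(p', q', r')]: a half-turn about the
    first axis if [b] holds, else the rotation about the third axis by the angle
    of cosine [c] and sine [s]. *)
Definition letter_step (b : bool) (p q r p' q' r' : R) : Prop :=
  if b then [/\ p' = p, q' = - q & r' = - r]
  else [/\ p' = c * p - s * q, q' = s * p + c * q & r' = r].

Hypothesis equiv : {ae mu, forall x : bernoulli_space,
  letter_step (x 0) (u x) (v x) (w x)
  (u (bernoulli_shift x)) (v (bernoulli_shift x)) (w (bernoulli_shift x))}.

Definition flip_dist (k : int) (x : bernoulli_space) : R :=
  (u (flip k x) - u x) ^+ 2 + (v (flip k x) - v x) ^+ 2 +
  (w (flip k x) - w x) ^+ 2.

Lemma measurable_flip_dist k : measurable_fun setT (flip_dist k).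
Proof.
have mf := (flip_preserving hmu k).1.
apply: measurable_funD; first apply: measurable_funD.
all: apply: measurable_funX; apply: measurable_funB => //.
all: exact: measurableT_comp.
Qed.

Lemma flip_dist_ge0 k x : 0 <= flip_dist k x.
Proof. by rewrite /flip_dist !addr_ge0 ?sqr_ge0. Qed.

(** For [k <> -1] the points [x] and [flip (k + 1) x] have the same letter at
    place 0, which acts by an isometry. *)
Lemma flip_dist_shift k : k != -1 ->
  {ae mu, forall x, flip_dist k (bernoulli_shift x) = flip_dist (k + 1) x}.
Proof.
move=> k1; have := ae_preimage (flip_preserving hmu (k + 1)) equiv.
apply: filterS2 equiv => x.
rewrite /flip_dist flip_shift /letter_step.
have -> : flip (k + 1) x 0 = x 0.
  by rewrite /flip eq_sym addr_eq0 (negbTE k1).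
case: ifP => _ [-> -> ->] [-> -> ->]; first ring.
set du := u (flip _ x); set dv := v (flip _ x); set dw := w (flip _ x).
transitivity ((c ^+ 2 + s ^+ 2) * ((du - u x) ^+ 2 + (dv - v x) ^+ 2) +
  (dw - w x) ^+ 2); first ring.
by rewrite cs mul1r.
Qed.

Lemma measurable_flip_dist_ge k (e : R) :
  measurable [set x | e <= flip_dist k x].
Proof. by apply: measurable_superlevel; exact: measurable_flip_dist. Qed.

Lemma flip_dist_step k (e : R) : k != -1 ->
  mu [set x | e <= flip_dist k x] = mu [set x | e <= flip_dist (k + 1) x].
Proof.
move=> k1; have mk := measurable_flip_dist_ge k e.
have mk1 := measurable_flip_dist_ge (k + 1) e.
have mT := bernoulli_shift_preserving hmu.
rewrite -(mT.2 _ mk).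
have mTk : measurable (bernoulli_shift @^-1` [set x | e <= flip_dist k x]).
  by rewrite -[X in measurable X]setTI; exact: mT.1.
apply/eqP; rewrite eq_le; apply/andP; split; apply: ae_le_measure => //.
  by apply: filterS (flip_dist_shift k1) => x /= ->.
by apply: filterS (flip_dist_shift k1) => x /= ->.
Qed.

(** Each of the three coordinates moves little in measure under a far flip. *)
Lemma flip_dist_vanishing (k : nat -> int) (e : R) : injective k -> 0 < e ->
  vanishing (fun n => mu [set x | e <= flip_dist (k n) x]).
Proof.
move=> kinj e0.
(* If each coordinate moves by less than [r], the squares of the displacements
   are at most [r <= e / 3], because [r <= 1]. *)
pose f n := flip (k n); pose r := Num.min 1 (e / 3).
have r0 : 0 < r by rewrite lt_min ltr01 divr_gt0.
have fP n : measure_preserving mu (f n) by exact: flip_preserving.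
have fi : forall E, measurable E -> asymp_invariant mu f E.
  exact: flip_asymp_invariant.
pose B (h : bernoulli_space -> R) n := [set x | r <= `|h (f n x) - h x|].
have mB h n : measurable_fun setT h -> measurable (B h n).
  move=> mh; apply: measurable_superlevel.
  exact: (measurable_displacement (fP n)).
apply: (@vanishingS _ _ _ mu _ (fun n => B u n `|` B v n `|` B w n)).
- by move=> n; exact: measurable_flip_dist_ge.
- by move=> n; do 2?apply: measurableU; exact: mB.
- move=> n x /= eD; apply: contrapT.
  move=> /not_orP[/not_orP[/negP nu /negP nv] /negP nw].
  suff : flip_dist (k n) x < e by rewrite ltNge eD.
  have small (t : R) : ~~ (r <= `|t|) -> t ^+ 2 < e / 3.
    rewrite -ltNge lt_min -real_normK ?num_real// => /andP[t1 te].
    apply: le_lt_trans te; rewrite expr2 -[leRHS]mul1r ler_wpM2r//; exact: ltW.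
  have := small _ nu; have := small _ nv; have := small _ nw.
  by rewrite /flip_dist -/(f n x); lra.
- apply: vanishingU; [..|exact: asymp_invariant_fun].
  + by move=> n; apply: measurableU; exact: mB.
  + by move=> n; exact: mB.
  + by apply: vanishingU; [move=> n; exact: mB..| |];
      exact: asymp_invariant_fun.
Qed.

(** Random variables that are equidistributed and tend to 0 in measure are 0
    almost everywhere. *)
Lemma flip_dist_eq0 (k : nat -> int) : injective k ->
  (forall n (e : R), mu [set x | e <= flip_dist (k n) x] =
    mu [set x | e <= flip_dist (k n.+1) x]) ->
  {ae mu, forall x, flip_dist (k 0%N) x = 0}.
Proof.
move=> kinj kS.
have null (e : R) : 0 < e -> mu [set x | e <= flip_dist (k 0%N) x] = 0%E.
  move=> e0.
  have const n : mu [set x | e <= flip_dist (k n) x] =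
      mu [set x | e <= flip_dist (k 0%N) x].
    by elim: n => // n <-; exact/esym/kS.
  apply/eqP; rewrite eq_le measure_ge0 andbT; apply/lee_addgt0Pr => r r0.
  have [N _ /(_ N (leqnn N))] := flip_dist_vanishing kinj e0 r0.
  by rewrite /= const add0e.
apply: (@negligibleS _ _ _ mu
  (\bigcup_n [set x | n.+1%:R^-1 <= flip_dist (k 0%N) x])).
  move=> x /= /eqP D0; have Dp : 0 < flip_dist (k 0%N) x.
    by rewrite lt_neqAle eq_sym D0 flip_dist_ge0.
  have [n nD] := ltr_add_invr Dp.
  by exists n => //=; rewrite -[leLHS]add0r ltW.
apply: negligible_bigcup => n; apply/negligibleP.
  exact: measurable_flip_dist_ge.
by apply: null; rewrite invr_gt0.
Qed.

Lemma flip_dist0 : {ae mu, forall x, flip_dist 0 x = 0}.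
Proof.
apply: (@flip_dist_eq0 (fun n => n%:Z)) => [m n []//|n e].
by rewrite flip_dist_step// intS addrC.
Qed.

Lemma flip_distN1 : {ae mu, forall x, flip_dist (-1) x = 0}.
Proof.
apply: (@flip_dist_eq0 (fun n => - n.+1%:Z)) => [m n /oppr_inj []//|n e].
rewrite (_ : - n.+1%:Z = - n.+2%:Z + 1).
  by rewrite -flip_dist_step// eqr_opp.
by rewrite [in RHS]intS opprD addrAC addNr add0r.
Qed.

Lemma flip_dist0E k x : flip_dist k x = 0 ->
  [/\ u (flip k x) = u x, v (flip k x) = v x & w (flip k x) = w x].
Proof.
move=> /eqP; rewrite /flip_dist !paddr_eq0 ?addr_ge0 ?sqr_ge0//.
by rewrite !expf_eq0 !subr_eq0 => /andP[/andP[/eqP-> /eqP->] /eqP->].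
Qed.

(** Changing the letter at place 0 affects neither [h x], by [flip_dist0], nor
    [h (T x)], by [flip_distN1] taken at [T x]; hence both letters send
    [h x = (u x, v x, w x)] to the same vector. *)
Lemma equivariant_letters :
  {ae mu, forall x,
    [/\ c * u x - s * v x = u x, s * u x + c * v x = - v x & w x = 0]}.
Proof.
have mT := bernoulli_shift_preserving hmu.
have equiv_flip := ae_preimage (flip_preserving hmu 0) equiv.
have eN1 := ae_preimage mT flip_distN1.
apply: filterS2 (filterI equiv equiv_flip) (filterI flip_dist0 eN1)
  => x /= [ex].
move=> + [/flip_dist0E[u0 v0 w0] /flip_dist0E].
rewrite flip_shift addNr => + [ux vx wx].
rewrite u0 v0 w0 ux vx wx; move: ex; rewrite /letter_step {1}/flip eqxx.
by case: (x 0) => /= -[e1 e2 e3] [e4 e5 e6]; split; lra.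
Qed.

(** By [equivariant_letters] at [x] the vector [h (T x)] is [(u x, - v x, 0)]
    whatever the letter, and it satisfies the same equations as [(u x, v x, 0)];
    subtracting leaves [s * u x = s * v x = 0]. *)
Lemma equivariant_eq0 :
  {ae mu, forall x, [/\ u x = 0, v x = 0 & w x = 0]}.
Proof.
have mT := bernoulli_shift_preserving hmu.
apply: filterS2 (filterI equiv equivariant_letters)
  (ae_preimage mT equivariant_letters) => x /= [ex [e1 e2 w0]] [].
have [-> -> _] : [/\ u (bernoulli_shift x) = u x,
    v (bernoulli_shift x) = - v x & w (bernoulli_shift x) = - w x].
  by move: ex; rewrite /letter_step e1 e2 w0 oppr0; case: (x 0).
move=> e3 e4 _.
have sv : s * v x = 0 by lra.
have su : s * u x = 0 by lra.
by split => //; apply: (mulfI s0); rewrite ?su ?sv mulr0.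
Qed.

End equivariant.

(** * Stokes parameters of a complex line *)

Section continuity.
Context (R : realType).

Lemma continuous_Re : continuous (fun z : R[i]^o => complex.Re z : R).
Proof.
move=> z A /nbhs_ballP[e /= e0 eA]; apply/nbhs_ballP.
exists e%:C; first by rewrite /= ltcR.
move=> y; rewrite -ball_normE /= => zy; apply: eA; rewrite -ball_normE /=.
by rewrite -ltcR (le_lt_trans _ zy)// -raddfB; exact: normc_ge_Re.
Qed.

Lemma continuous_Im : continuous (fun z : R[i]^o => complex.Im z : R).
Proof.
move=> z A /nbhs_ballP[e /= e0 eA]; apply/nbhs_ballP.
exists e%:C; first by rewrite /= ltcR.
move=> y; rewrite -ball_normE /= => zy; apply: eA; rewrite -ball_normE /=.
rewrite -ltcR (le_lt_trans _ zy)// -raddfB normc_def lecR -sqrtr_sqr.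
by rewrite ler_wsqrtr// lerDr sqr_ge0.
Qed.

Lemma continuous_entry_Re i j :
  continuous (fun m : 'M[R[i]^o]_(2, 1) => complex.Re (m i j) : R).
Proof.
move=> m; apply: (@continuous_comp _ _ _ (fun m : 'M[R[i]^o]_(2, 1) => m i j)).
  exact: coord_continuous.
exact: continuous_Re.
Qed.

Lemma continuous_entry_Im i j :
  continuous (fun m : 'M[R[i]^o]_(2, 1) => complex.Im (m i j) : R).
Proof.
move=> m; apply: (@continuous_comp _ _ _ (fun m : 'M[R[i]^o]_(2, 1) => m i j)).
  exact: coord_continuous.
exact: continuous_Im.
Qed.
End continuity.

Section stokes.
Context (R : realType).
Implicit Types (m : 'cV[R[i]]_2) (V : grassmannian R).

(** The squared hermitian norm; [stokes_u], [stokes_v] and [stokes_w] below are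
    the other three Stokes parameters [|p|^2 - |q|^2], [2 Re (p q^* )] and
    [2 Im (p q^* )] of the vector [(p, q)], where [^*] is conjugation. *)
Definition hnorm m : R :=
  complex.Re (m 0 0) ^+ 2 + complex.Im (m 0 0) ^+ 2 +
  complex.Re (m 1 0) ^+ 2 + complex.Im (m 1 0) ^+ 2.

Definition stokes_u m : R :=
  complex.Re (m 0 0) ^+ 2 + complex.Im (m 0 0) ^+ 2 -
  complex.Re (m 1 0) ^+ 2 - complex.Im (m 1 0) ^+ 2.

Definition stokes_v m : R :=
  2 * (complex.Re (m 0 0) * complex.Re (m 1 0) +
       complex.Im (m 0 0) * complex.Im (m 1 0)).

Definition stokes_w m : R :=
  2 * (complex.Im (m 0 0) * complex.Re (m 1 0) -
       complex.Re (m 0 0) * complex.Im (m 1 0)).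

(** What makes the quotient of a Stokes parameter by [hnorm] a bounded Borel
    function of the line spanned by the vector. *)
Definition hermitian_form (Q : 'cV[R[i]]_2 -> R) : Prop :=
  [/\ forall a m, Q (a *: m) = (complex.Re a ^+ 2 + complex.Im a ^+ 2) * Q m,
      forall m, `|Q m| <= hnorm m &
      continuous (fun m : 'M[R[i]^o]_(2, 1) => Q m)].

Lemma continuous_mul (T : topologicalType) (f g : T -> R) :
  continuous f -> continuous g -> continuous (fun x => f x * g x).
Proof. by move=> cf cg x; apply: cvgM; [exact: cf|exact: cg]. Qed.

Lemma continuous_add (T : topologicalType) (f g : T -> R) :
  continuous f -> continuous g -> continuous (fun x => f x + g x).
Proof. by move=> cf cg x; apply: cvgD; [exact: cf|exact: cg]. Qed.

Lemma continuous_opp (T : topologicalType) (f : T -> R) :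
  continuous f -> continuous (fun x => - f x).
Proof. by move=> cf x; apply: cvgN; exact: cf. Qed.

Lemma continuous_sqr (T : topologicalType) (f : T -> R) :
  continuous f -> continuous (fun x => f x ^+ 2).
Proof. by move=> cf; exact: continuous_mul. Qed.

Ltac continuity := repeat lazymatch goal with
  | |- continuous (fun _ => _ + _) => apply: continuous_add
  | |- continuous (fun _ => _ ^+ 2) => apply: continuous_sqr
  | |- continuous (fun _ => - _) => apply: continuous_opp
  | |- continuous (fun _ => _ * _) => apply: continuous_mul
  | |- continuous (fun _ => complex.Re _) => exact: continuous_entry_Re
  | |- continuous (fun _ => complex.Im _) => exact: continuous_entry_Im
  | |- continuous (fun _ => 2) => exact: cst_continuous
  end.

Ltac form_scale a m := rewrite !mxE;
  case: a (m 0 0) (m 1 0) => [? ?] [? ?] [? ?] /=; ring.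

Lemma hnorm_form : hermitian_form hnorm.
Proof.
split; first by move=> a m; rewrite /hnorm; form_scale a m.
- by move=> m; rewrite ger0_norm// /hnorm !addr_ge0// sqr_ge0.
- by rewrite /hnorm; continuity.
Qed.

Lemma stokes_u_form : hermitian_form stokes_u.
Proof.
split; first by move=> a m; rewrite /stokes_u; form_scale a m.
- move=> m; rewrite ler_norml /hnorm /stokes_u.
  case: (m 0 0) (m 1 0) => [a b] [c d] /=.
  have := sqr_ge0 a; have := sqr_ge0 b.
  have := sqr_ge0 c; have := sqr_ge0 d.
  by move=> ????; apply/andP; split; lra.
- by rewrite /stokes_u; continuity.
Qed.

Lemma stokes_v_form : hermitian_form stokes_v.
Proof.
split; first by move=> a m; rewrite /stokes_v; form_scale a m.
- move=> m; rewrite ler_norml /hnorm /stokes_v.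
  case: (m 0 0) (m 1 0) => [a b] [c d] /=.
  have := sqr_ge0 (a - c); have := sqr_ge0 (a + c).
  have := sqr_ge0 (b - d); have := sqr_ge0 (b + d).
  by move=> ????; apply/andP; split; lra.
- by rewrite /stokes_v; continuity.
Qed.

Lemma stokes_w_form : hermitian_form stokes_w.
Proof.
split; first by move=> a m; rewrite /stokes_w; form_scale a m.
- move=> m; rewrite ler_norml /hnorm /stokes_w.
  case: (m 0 0) (m 1 0) => [a b] [c d] /=.
  have := sqr_ge0 (b - c); have := sqr_ge0 (b + c).
  have := sqr_ge0 (a - d); have := sqr_ge0 (a + d).
  by move=> ????; apply/andP; split; lra.
- by rewrite /stokes_w; continuity.
Qed.

Lemma hnorm_ge0 m : 0 <= hnorm m.
Proof. by rewrite /hnorm !addr_ge0// sqr_ge0. Qed.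

Lemma hnorm_eq0 m : (hnorm m == 0) = (m == 0).
Proof.
apply/idP/eqP => [|->]; last by rewrite /hnorm !mxE /=; apply/eqP; ring.
rewrite /hnorm !paddr_eq0 ?addr_ge0 ?sqr_ge0// !expf_eq0/=.
move=> /andP[/andP[/andP[]]] /eqP a0 /eqP b0 /eqP c0 /eqP d0.
apply/colP => i; rewrite mxE.
case: i => -[|[|//]] ilt.
  rewrite (_ : Ordinal ilt = 0); last exact: val_inj.
  by move: a0 b0; case: (m 0 0) => /= ? ? -> ->.
rewrite (_ : Ordinal ilt = 1); last exact: val_inj.
by move: c0 d0; case: (m 1 0) => /= ? ? -> ->.
Qed.

Lemma hnorm_gt0 m : (0 < hnorm m) = (m != 0).
Proof. by rewrite lt_neqAle hnorm_ge0 andbT eq_sym hnorm_eq0. Qed.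

Lemma stokes_sphere m :
  stokes_u m ^+ 2 + stokes_v m ^+ 2 + stokes_w m ^+ 2 = hnorm m ^+ 2.
Proof. rewrite /stokes_u /stokes_v /stokes_w /hnorm; ring. Qed.

(** The value of [Q / hnorm] on a line does not depend on the generator
    ([chart_line]), so any of them may be used.  The value 0 on the subspaces
    that are not lines is arbitrary. *)
Definition chart (Q : 'cV[R[i]]_2 -> R) V : R :=
  if \dim V == 1%N then Q (vpick V) / hnorm (vpick V) else 0.

Lemma line_generator V m : \dim V = 1%N -> m \in V -> m != 0 ->
  exists2 a : R[i], m = a *: vpick V & a != 0.
Proof.
move=> V1 mV m0; have V0 : vpick V != 0 by rewrite vpick0 -dimv_eq0 V1.
have VE : <[vpick V]>%VS = V.
  by apply/eqP; rewrite eqEdim -memvE memv_pick V1 dim_vline V0.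
have /vlineP[a ma] : m \in <[vpick V]>%VS by rewrite VE.
exists a => //; apply: contra_neq m0 => a0.
by rewrite ma a0 scale0r.
Qed.

Lemma chart_line Q V m :
  hermitian_form Q -> \dim V = 1%N -> m \in V -> m != 0 ->
  chart Q V = Q m / hnorm m.
Proof.
move=> [QZ _ _] V1 mV m0; rewrite /chart V1 eqxx.
have [a -> a0] := line_generator V1 mV m0.
have [hZ _ _] := hnorm_form; rewrite QZ hZ -mulf_div divff ?mul1r//.
move: a0; apply: contra_neq; case: a => a b /= ab.
have : a ^+ 2 + b ^+ 2 == 0 by apply/eqP.
by rewrite paddr_eq0 ?sqr_ge0// !expf_eq0/= => /andP[/eqP-> /eqP->].
Qed.

Lemma chart_le1 Q V : hermitian_form Q -> `|chart Q V| <= 1.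
Proof.
move=> [_ Q1 _]; rewrite /chart; case: ifP; last by rewrite normr0 ler01.
rewrite normrM normfV (ger0_norm (hnorm_ge0 _)) => /eqP V1.
by rewrite ler_pdivrMr ?mul1r// hnorm_gt0 vpick0 -dimv_eq0 V1.
Qed.

Lemma mximg_full_rank k (M : 'M[R[i]]_(2, k)) :
  \rank M = k -> \dim (mximg M fullv) = k.
Proof.
move=> Mk; rewrite /mximg limg_dim_eq ?dimvf ?/dim/= ?muln1//.
apply/eqP; rewrite capfv; apply/lker0P => x y.
rewrite !lfunE /= => /(congr1 trmx); rewrite !trmx_mul.
move/row_free_inj => xy; apply: trmx_inj; apply: xy.
by rewrite /row_free mxrank_tr Mk.
Qed.

Lemma mem_mximg (n k : nat) (M : 'M[R[i]]_(n, k)) (U : {vspace 'cV[R[i]]_k})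
    (y : 'cV[R[i]]_k) : y \in U -> M *m y \in mximg M U.
Proof. by move=> yU; apply/memv_imgP; exists y => //; rewrite lfunE. Qed.

(** A set of lines given by an open cone of generators is open, as only matrices
    with a single column have both full rank and a line as column space. *)
Lemma grass_open_lines (P : set 'cV[R[i]]_2) :
  open [set m : 'M[R[i]^o]_(2, 1) | P m] ->
  (forall a m, a != 0 -> P m -> P (a *: m)) ->
  grass_open [set V | \dim V = 1%N /\ exists2 m, m \in V & m != 0 /\ P m].
Proof.
move=> oP Pscale k.
have [->|k1] := eqVneq k 1%N; last first.
  rewrite (_ : mkset _ = set0); first exact: open0.
  rewrite -subset0 => M /= [Mk]; rewrite mximg_full_rank// => -[k1' _].
  by rewrite k1' eqxx in k1.
rewrite (_ : mkset _ = [set m : 'M[R[i]^o]_(2, 1) | 0 < hnorm m] `&`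
  [set m : 'M[R[i]^o]_(2, 1) | P m]).
  apply: openI => //.
  have [_ _ hc] := hnorm_form.
  apply: (open_comp (D := [set t : R | 0 < t])); last exact: open_gt.
  by move=> m _; exact: hc.
have rank1 (M : 'M[R[i]]_(2, 1)) : \rank M = 1%N <-> M != 0.
  rewrite -mxrank_eq0; have := rank_leq_col M; by case: (\rank M) => [|[|]].
have spanM (M : 'M[R[i]]_(2, 1)) : M \in mximg M fullv.
  by rewrite -[X in X \in _]mulmx1 mem_mximg// memvf.
apply/seteqP; split => M /=; rewrite hnorm_gt0.
  move=> [/rank1 M0 [M1 [m mM [m0 Pm]]]]; split => //.
  have [a ma a0] := line_generator M1 mM m0.
  have [b Mb b0] := line_generator M1 (spanM M) M0.
  have -> : M = (b / a) *: m by rewrite ma scalerA divfK.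
  by apply: Pscale => //; rewrite mulf_neq0// invr_eq0.
move=> [M0 PM]; have Mr : \rank (M : 'M[R[i]]_(2, 1)) = 1%N by apply/rank1.
split => //; split; first exact: mximg_full_rank.
by exists M => //.
Qed.

(** For a line [V], [t < chart Q V] means that its generators lie in the open
    cone [0 < Q m - t * hnorm m].  The other subspaces form a measurable set, on
    which the chart is constant. *)
Lemma measurable_chart Q : hermitian_form Q ->
  measurable_fun setT (chart Q : grass_borel R -> R).
Proof.
move=> QP; have [QZ Q1 Qc] := QP.
apply: (measurability _ (RGenOInfty.measurableE R)) => _ [_ [t ->] <-].
have mlines : measurable ([set V | \dim V = 1%N] : set (grass_borel R)).
  apply: sub_sigma_algebra.
  have := @grass_open_lines setT openT (fun _ _ _ _ => I).
  congr grass_open; apply/seteqP; split=> V /= ; first by case.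
  move=> V1; split => //; exists (vpick V); rewrite ?memv_pick//.
  by rewrite vpick0 -dimv_eq0 V1.
have mP : measurable
    ([set V | \dim V = 1%N /\ t < chart Q V] : set (grass_borel R)).
  apply: sub_sigma_algebra.
  have [hZ _ hc] := hnorm_form.
  have := @grass_open_lines [set m | 0 < Q m - t * hnorm m] _ _.
  have -> : [set V : grassmannian R | \dim V = 1%N /\ t < chart Q V] =
    [set V | \dim V = 1%N /\
      exists2 m, m \in V & m != 0 /\ 0 < Q m - t * hnorm m].
    apply/seteqP; split=> V /= [V1 Vm]; split => //.
      have V0 : vpick V != 0 by rewrite vpick0 -dimv_eq0 V1.
      exists (vpick V); rewrite ?memv_pick//; split => //.
      by move: Vm; rewrite /chart V1 eqxx ltr_pdivlMr ?hnorm_gt0// subr_gt0.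
    move: Vm => [m mV [m0]]; rewrite (chart_line QP V1 mV m0).
    by rewrite ltr_pdivlMr ?hnorm_gt0// subr_gt0.
  apply.
    apply: (open_comp (D := [set t : R | 0 < t])); last exact: open_gt.
    move=> m _; apply: continuous_add => //; apply: continuous_opp.
    by apply: continuous_mul => //; exact: cst_continuous.
  move=> a m a0 /= Pm; rewrite QZ hZ mulrCA -mulrBr mulr_gt0//.
  rewrite lt_neqAle addr_ge0 ?sqr_ge0// andbT eq_sym.
  move: a0; apply: contraNneq; case: a => a b /= /eqP.
  by rewrite paddr_eq0 ?sqr_ge0// !expf_eq0/= => /andP[/eqP-> /eqP->].
rewrite setTI.
have -> : chart Q @^-1` `]t, +oo[ = [set V | \dim V = 1%N /\ t < chart Q V] `|`
   (if t < 0 then ~` [set V : grassmannian R | \dim V = 1%N] else set0).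
  apply/seteqP; split => V /=; rewrite in_itv /= andbT.
    have [V1|/eqP V1] := eqVneq (\dim V) 1%N; first by left.
    by rewrite /chart (negbTE (introN eqP V1)) => ->; right.
  move=> [[]//|]; case: ifP => //= t0 V1.
  by rewrite /chart (negbTE (introN eqP V1)).
apply: measurableU => //; case: ifP => // _; exact: measurableC.
Qed.
End stokes.

(** * The rotation and reflection cocycle *)

Section rot_refl.
Context (R : realType) (alpha : R).
Let c2 := cos (pi * alpha) ^+ 2 - sin (pi * alpha) ^+ 2.
Let s2 := 2 * cos (pi * alpha) * sin (pi * alpha).

Lemma mx2_mulE (a b c d : R[i]) (m : 'cV[R[i]]_2) :
  (mx2 a b c d *m m) 0 0 = a * m 0 0 + b * m 1 0 /\
  (mx2 a b c d *m m) 1 0 = c * m 0 0 + d * m 1 0.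
Proof.
rewrite !mxE !big_ord_recl !big_ord0 !mxE /= !addr0.
by rewrite (_ : lift ord0 ord0 = 1 :> 'I_2); [split|exact: val_inj].
Qed.

(** The two matrices act on the Stokes parameters by rigid motions; the rotation
    by [pi * alpha] turns [(stokes_u, stokes_v)] by twice that angle. *)
Lemma stokes_rot_refl x (m : 'cV[R[i]]_2) (m' := rot_refl alpha x *m m) :
  hnorm m' = hnorm m /\
  letter_step c2 s2 (x 0) (stokes_u m) (stokes_v m) (stokes_w m)
    (stokes_u m') (stokes_v m') (stokes_w m').
Proof.
have cs := cos2Dsin2 (pi * alpha).
rewrite /m' /rot_refl /letter_step /hnorm /stokes_u /stokes_v /stokes_w /c2 /s2.
case: (x 0); first have [-> ->] := mx2_mulE 1 0 0 (-1) m.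
  by case: (m 0 0) (m 1 0) => a b [c d] /=; split; [|split]; ring.
set C := cos _ in cs *; set S := sin _ in cs *.
have [-> ->] := mx2_mulE C%:C (- S)%:C S%:C C%:C m.
case: (m 0 0) (m 1 0) => a b [c d] /=.
have csE t : t = (C ^+ 2 + S ^+ 2) * t by rewrite cs mul1r.
by split; [rewrite [RHS]csE|split; [| |rewrite [RHS]csE]]; ring.
Qed.

Lemma rot_refl_inj x (m : 'cV[R[i]]_2) : rot_refl alpha x *m m = 0 -> m = 0.
Proof.
move=> Am0; apply/eqP; rewrite -hnorm_eq0 -(stokes_rot_refl x m).1 Am0.
by rewrite hnorm_eq0.
Qed.

(** For [alpha] in (0, 1) the only zero of [sin (2 pi alpha)] is at 1/2. *)
Lemma sin_double_neq0 : 0 < alpha < 1 -> irrational alpha -> s2 != 0.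
Proof.
move=> /andP[a0 a1] airr; rewrite /s2 !mulf_neq0 ?pnatr_eq0//; last first.
  rewrite gt_eqF// sin_gt0_pi// mulr_gt0 ?pi_gt0//=.
  by rewrite gtr_pMr ?pi_gt0.
apply/eqP => c0; apply: airr; rewrite /rational.
have p0 := pi_gt0 R.
have : pi * alpha = pi / 2.
  apply: cos_inj; rewrite ?cos_pihalf// in_itv/=; apply/andP; split; nra.
move=> /(mulfI (lt0r_neq0 p0)) ->.
by exists (2^-1) => //; rewrite fmorphV /= ratr_nat.
Qed.

End rot_refl.

Theorem proposition4p3 (R : realType) (mu : probability bernoulli_space R)
    (hmu : bernoulli_half mu) (alpha : R) (halpha : 0 < alpha < 1)
    (hirr : irrational alpha) :
  irreducible mu bernoulli_shift
    (cocycle bernoulli_shift bernoulli_unshift (rot_refl alpha))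
    (@trivial_bundle R _ bernoulli_space).
Proof.
have A1 x : cocycle bernoulli_shift bernoulli_unshift (rot_refl alpha) 1 x =
    rot_refl alpha x by rewrite /= mulmx1.
split.
  split; first exact: measurable_cst.
  exists setT; split => //; first by rewrite probability_setT.
  (* The matrices are injective, hence map C^2 onto itself. *)
  move=> x _; rewrite A1 /trivial_bundle; apply/eqP; rewrite eqEdim subvf/=.
  rewrite /mximg limg_dim_eq//; apply/eqP; rewrite capfv; apply/lker0P => m n.
  rewrite !lfunE /= => /eqP; rewrite -subr_eq0 -mulmxBr.
  by move=> /eqP/rot_refl_inj/eqP; rewrite subr_eq0 => /eqP.
move=> [W [[mW [X' [mX' X'1 _ X'W]]] Wline]].
pose h Q x := chart Q (W x).
have mh Q : hermitian_form Q -> measurable_fun setT (h Q).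
  by move=> QP; apply: measurableT_comp mW; exact: measurable_chart.
have line : {ae mu, forall x, \dim (W x) = 1%N}.
  apply: filterS Wline => x [[_ W0] [WT WnT]].
  have dim2 : \dim (trivial_bundle R x) = 2%N by rewrite dimvf.
  have := dimvS WT; rewrite dim2; case DW : (\dim (W x)) => [|[|[|]]] // _.
    by case: W0; apply/esym/eqP; rewrite -dimv_eq0 DW.
  by case: WnT; apply/eqP; rewrite eqEdim WT dim2 DW.
have X'ae : {ae mu, forall x, X' x}.
  exists (~` X'); split => //; first exact: measurableC.
  by rewrite probability_setC// X'1 subee.
have equiv : {ae mu, forall x,
  letter_step (cos (pi * alpha) ^+ 2 - sin (pi * alpha) ^+ 2)
    (2 * cos (pi * alpha) * sin (pi * alpha)) (x 0)
    (h (@stokes_u R) x) (h (@stokes_v R) x) (h (@stokes_w R) x)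
    (h (@stokes_u R) (bernoulli_shift x)) (h (@stokes_v R) (bernoulli_shift x))
    (h (@stokes_w R) (bernoulli_shift x))}.
  have lineT := ae_preimage (bernoulli_shift_preserving hmu) line.
  apply: filterS3 X'ae line lineT => x X'x W1 WT1.
  set m := vpick (W x).
  have mW' : m \in W x by exact: memv_pick.
  have m0 : m != 0 by rewrite vpick0 -dimv_eq0 W1.
  have AmW : rot_refl alpha x *m m \in W (bernoulli_shift x).
    by rewrite -X'W// A1; exact: mem_mximg.
  have Am0 : rot_refl alpha x *m m != 0.
    by apply: contra_neq m0; exact: rot_refl_inj.
  have hE Q : hermitian_form Q -> h Q x = Q m / hnorm m /\
      h Q (bernoulli_shift x) = Q (rot_refl alpha x *m m) / hnorm m.
    move=> QP; rewrite /h (chart_line QP W1 mW' m0) (chart_line QP WT1 AmW Am0).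
    by rewrite (stokes_rot_refl alpha x m).1.
  have [-> ->] := hE _ (stokes_u_form R).
  have [-> ->] := hE _ (stokes_v_form R).
  have [-> ->] := hE _ (stokes_w_form R).
  have := (stokes_rot_refl alpha x m).2; rewrite /letter_step.
  by case: (x 0) => -[-> -> ->]; split; ring.
have cs : (cos (pi * alpha) ^+ 2 - sin (pi * alpha) ^+ 2) ^+ 2 +
    (2 * cos (pi * alpha) * sin (pi * alpha)) ^+ 2 = 1.
  transitivity ((cos (pi * alpha) ^+ 2 + sin (pi * alpha) ^+ 2) ^+ 2).
    ring.
  by rewrite cos2Dsin2 expr1n.
have zero := equivariant_eq0 hmu cs (sin_double_neq0 halpha hirr)
  (mh _ (stokes_u_form R)) (mh _ (stokes_v_form R)) (mh _ (stokes_w_form R))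
  (fun x => chart_le1 (W x) (stokes_u_form R))
  (fun x => chart_le1 (W x) (stokes_v_form R))
  (fun x => chart_le1 (W x) (stokes_w_form R)) equiv.
have pmu : ProperFilter (almost_everywhere mu).
  apply: ae_properfilter_algebraOfSetsType.
  by rewrite [X in (_ < X)%E](_ : _ = 1%E) ?lte01//; exact: probability_setT.
(* A single point where [W] is a line with zero Stokes parameters is absurd. *)
have [x [W1 [u0 v0 w0]]] := filter_ex (filterI line zero).
set m := vpick (W x).
have m0 : 0 < hnorm m by rewrite hnorm_gt0 vpick0 -dimv_eq0 W1.
have hm : hnorm m != 0 by rewrite gt_eqF.
have Qm Q : h Q x = 0 -> Q m = 0.
  rewrite /h /chart W1 eqxx -/m => /eqP.
  by rewrite mulf_eq0 invr_eq0 (negbTE hm) orbF => /eqP.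
have := stokes_sphere m; rewrite (Qm _ u0) (Qm _ v0) (Qm _ w0).
by move/eqP; rewrite expr0n/= !addr0 eq_sym expf_eq0/= (negbTE hm).
Qed.
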